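(* Let $L>0$ be any integer. For $k=1,2,\ldots$ let $\bar B^{\mathrm u}_k=B^{\mathrm u}(n_0+k+Lk,\underline w^{(k+Lk)})$ be any u-bridge with $\bar B^{\mathrm u}_k\subset B^{\mathrm u}_k$, and let $\underline u^{(k)}$ be any code with $|\underline u^{(k)}|\ge0$. Then there exist codes $\underline{\widehat w}^{(k)}$ and sub-bridges $\widehat B^{\mathrm u}_k=B^{\mathrm u}(\widehat n_k,\underline{\widehat w}^{(k)})$ of $\bar B^{\mathrm u}_k$ ($k=1,2,\dots$) satisfying the following conditions. (1) $\underline{\widehat w}^{(k)}=\underline w^{(k+Lk)}\,\underline v^{(k)}\,\underline\gamma^{(k)}$, where - $\underline\gamma^{(k)}=\gamma_{m_k}\gamma_{m_k-1}\cdots\gamma_2\gamma_1$ with $\gamma_i\in\{0,1\}$ $(i=1,\dots,m_k)$, for some integer $m_k$ satisfying $0<m_k\le N_0+N_1k$, where $N_0,N_1$ are positive integers independent of $k$; - either $\underline v^{(k)}=\underline u^{(k)}$ or $\underline v^{(k)}=\underline u^{(k)}\alpha$ for some $\alpha\in\{0,1\}$. (2) $\boldsymbol\zeta_{\underline{\widehat w}^{(k)}}(1/2)\in\bar J^{\mathrm{cs}}_{k+1}$ and $\widehat J^{\mathrm{cs}}_{k+1}\subset\bar J^{\mathrm{cs}}_{k+1}$, where $\bar J^{\mathrm{cs}}_{k+1}$ and $\widehat J^{\mathrm{cs}}_{k+1}$ are the cs-intervals associated with $\bar B^{\mathrm u}_{k+1}$ and $\widehat B^{\mathrm u}_{k+1}$,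 respectively.
   Context: Constants: $\lambda_{ss},\lambda_{cs0},\lambda_{cs1},\lambda_u>0$ with $\lambda_{ss}<\lambda_{cs0}<1/2<\lambda_{cs1}<1<\lambda_{cs0}+\lambda_{cs1}$, $2<\lambda_u$, $\lambda_{cs0}\lambda_{cs1}\lambda_u^2<1$; $\beta=1-\lambda_{cs1}$; $a_2>0$. On $[0,1]$ let $\zeta_0(z)=\lambda_{cs0}z$, $\zeta_1(z)=\lambda_{cs1}z+\beta$. A code is a finite word in $\{0,1\}$, $|\cdot|$ is its length; juxtaposition is concatenation. For a code $\underline\gamma=\gamma_1\cdots\gamma_n$ put $\boldsymbol\zeta_{\underline\gamma}=\zeta_{\gamma_n}\circ\cdots\circ\zeta_{\gamma_1}$. u-bridges: let $\xi_0(x)=\lambda_ux$ on $V_0=[0,\lambda_u^{-1}]$ and $\xi_1(x)=\lambda_u(1-x)$ on $V_1=[1-\lambda_u^{-1},1]$. (These are the $x$-components of the blender-horseshoe map $f$, with $f(x,y,z)=(\lambda_ux,\lambda_{ss}y,\lambda_{cs0}z)$ for $x\in V_0$, and $f(x,y,z)=(\lambda_u(1-x),1-\lambda_{ss}y,\lambda_{cs1}z+\beta)$ for $x\in V_1$, $(x,y,z)\in[0,1]^3$.) For a code $\underline w=w_1\cdots w_n$ the u-bridge $B^{\mathrm u}(n;\underline w)=B^{\mathrm u}(n,\underline w)\subset[0,1]$ is the closed interval of points $x$ with $x\in V_{w_1}$ and $\xi_{w_{i-1}}\circ\cdots\circ\xi_{w_1}(x)\in V_{w_i}$ for $i=2,\dots,n$;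 it has length $\lambda_u^{-n}$. A sub-bridge of a u-bridge is a u-bridge contained in it; the maximal (proper) sub-bridges of $B^{\mathrm u}(\underline w)$ are $B^{\mathrm u}(\underline w0)$ and $B^{\mathrm u}(\underline w1)$. The sequence $B_k^{\mathrm u}$: fix $n_0\ge0$ and a code $\underline{\widetilde w}^{(0)}\in\{0,1\}^{n_0}$ such that $\widetilde B^{\mathrm u}_0=B^{\mathrm u}(n_0,\underline{\widetilde w}^{(0)})\subset(0,a_2)$. For $k\ge1$, let $B_k^{\mathrm u}=B^{\mathrm u}(n_0+k,\underline w^{(k)})$ and $\widetilde B_k^{\mathrm u}=B^{\mathrm u}(n_0+k,\underline{\widetilde w}^{(k)})$ be the two maximal sub-bridges of $\widetilde B_{k-1}^{\mathrm u}$, where $\widetilde B_k^{\mathrm u}$ lies to the left of $B_k^{\mathrm u}$. In the claim $\underline w^{(k+Lk)}$ denotes a code of length $n_0+k+Lk$ with initial segment $\underline w^{(k)}$, that is, the itinerary of a generation-$(n_0+k+Lk)$ sub-bridge of $B_k^{\mathrm u}$. cs-intervals: the cs-interval associated with a u-bridge $B\subset\widetilde B_0^{\mathrm u}$ is $J=a_2^{-1}B\subset[0,1]$. *)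

(* Defs.v *)
From mathcomp Require Import all_boot all_order all_algebra.
From mathcomp Require Import mathcomp_extra boolp classical_sets set_interval reals.

Set Implicit Arguments.
Unset Strict Implicit.
Unset Printing Implicit Defensive.

Import Order.TTheory GRing.Theory Num.Theory.

Local Open Scope classical_set_scope.
Local Open Scope ring_scope.

(* The letters 0 and 1 are [false] and [true]; [w1; ...; wn] is w1...wn. *)
Definition code := seq bool.

Section Blender.
Variable R : realType.
Implicit Types (x z : R) (w : code) (a : bool).

Definition zeta (lcs0 lcs1 : R) a z : R :=
  if a then lcs1 * z + (1 - lcs1) else lcs0 * z.

(* The first letter of the code acts first. *)
Definition zeta_code (lcs0 lcs1 : R) w z : R :=
  foldl (fun y a => zeta lcs0 lcs1 a y) z w.

Definition xi (lu : R) a x : R := if a then lu * (1 - x) else lu * x.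

Definition V (lu : R) a : set R :=
  if a then `[1 - lu^-1, 1]%classic else `[0, lu^-1]%classic.

Definition xi_code (lu : R) w x : R := foldl (fun y a => xi lu a y) x w.

(* B^u(size w; w). Positions in w are numbered from 0, so the condition at i
   constrains the image of x under the maps of the i letters before nth i.
   The bridge of the empty code is [0, 1]. *)
Definition ubridge (lu : R) w : set R :=
  [set x | `[0, 1]%classic x /\
    forall i, (i < size w)%N -> V lu (nth false w i) (xi_code lu (take i w) x)].

Definition left_of (A B : set R) : Prop :=
  forall x y : R, A x -> B y -> x < y.

(* wt k and w k are the codes of \tilde B_k and B_k; the value w 0 is
   irrelevant. The two maximal proper sub-bridges of ubridge lu s have codes
   s0 and s1; a is the letter of the left one. *)
Definition bridge_codes (lu : R) (n0 : nat) (wt w : nat -> code) : Prop :=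
  size (wt 0%N) = n0 /\
  forall k, (0 < k)%N -> exists a : bool,
    [/\ wt k = rcons (wt k.-1) a,
        w k = rcons (wt k.-1) (~~ a) &
        left_of (ubridge lu (wt k)) (ubridge lu (w k))].

Definition cs_interval (a2 : R) (B : set R) : set R := [set a2^-1 * x | x in B].

End Blender.

(* Main.v *)
Require Import Defs.
From mathcomp Require Import all_boot all_order all_algebra.
From mathcomp Require Import mathcomp_extra boolp classical_sets set_interval reals.
From mathcomp Require Import lra.

Import Order.TTheory GRing.Theory Num.Theory.

Local Open Scope classical_set_scope.
Local Open Scope ring_scope.

(** The maps zeta_0 and zeta_1 are contractions of [0, 1] with rate at most
    lcs1 < 1, and lcs0 + lcs1 > 1 makes their images [0, lcs0] and
    [1 - lcs1, 1] cover [0, 1].  Hence any point y of [0, 1] can be pulled back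
    m times by suitable inverse branches without leaving [0, 1]; the word g
    recorded in this way sends the whole of [0, 1] into an interval of length at
    most lcs1 ^ m around y ([zeta_code_dense]).  So an interval of radius r
    inside [0, 1] is reached from an arbitrary starting point by any number m of
    steps with lcs1 ^ m <= r.

    The target is the cs-interval of wbar (k + 1).  A bridge with a code of
    length n contains an interval of radius lu ^ -n / 2 ([ubridge_center]), and
    that code has length affine in k, so the radius of the target is a constant
    times an exponential in k.  An m affine in k therefore suffices
    ([expr_le_geometric]), which is the bound N0 + N1 k on the correcting word
    gam k: it steers the point zeta_(wbar k ++ u k) (1/2), wherever it is, to
    the center of the target.  The target lies in [0, 1] because the bridges
    are nested in the initial bridge, which lies in ]0, a2[. *)

(** * The contracting maps *)

Section ContractingMaps.
Variables (R : realType) (l0 l1 : R).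

Lemma zeta_unit a z :
  0 < l0 -> l0 <= l1 -> l1 < 1 -> 0 <= z <= 1 -> 0 <= zeta l0 l1 a z <= 1.
Proof.
move=> l0_gt0 l0_le l1_lt1 /andP[z_ge0 z_le1].
have l0z : 0 <= l0 * z by rewrite mulr_ge0 // ltW.
have l0Cz : 0 <= l0 * (1 - z) by rewrite mulr_ge0 ?subr_ge0 ?(ltW l0_gt0).
have l1_ge0 : 0 <= l1 by lra.
have l1z : 0 <= l1 * z by rewrite mulr_ge0 //; lra.
have l1Cz : 0 <= l1 * (1 - z) by rewrite mulr_ge0 //; lra.
by case: a => /=; lra.
Qed.

Lemma zeta_code_unit s z :
  0 < l0 -> l0 <= l1 -> l1 < 1 ->
  0 <= z <= 1 -> 0 <= zeta_code l0 l1 s z <= 1.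
Proof.
move=> l0_gt0 l0_le l1_lt1.
by elim: s z => //= a s IHs z z01; apply/IHs/zeta_unit.
Qed.

Lemma zeta_contract a x y : 0 < l0 -> l0 <= l1 ->
  `|zeta l0 l1 a x - zeta l0 l1 a y| <= l1 * `|x - y|.
Proof.
move=> l0_gt0 l0_le; have l1_ge0 : 0 <= l1 by lra.
case: a => /=.
  by rewrite opprD addrACA subrr addr0 -mulrBr normrM ger0_norm.
by rewrite -mulrBr normrM (gtr0_norm l0_gt0) ler_wpM2r.
Qed.

(** The images [0, l0] and [1 - l1, 1] overlap as soon as l0 + l1 >= 1. *)
Lemma zeta_cover y :
  0 < l0 -> l0 <= l1 -> l1 < 1 -> 1 <= l0 + l1 ->
  0 <= y <= 1 ->
  exists a, exists2 x, 0 <= x <= 1 & zeta l0 l1 a x = y.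
Proof.
move=> l0_gt0 l0_le l1_lt1 l01 y01; have [y_le|y_gt] := leP y l0.
  exists false, (y / l0) => /=; last by rewrite mulrC divfK // gt_eqF.
  by rewrite divr_ge0 ?ler_pdivrMr ?mul1r ?(ltW l0_gt0) //; lra.
have l1_gt0 : 0 < l1 by lra.
exists true, ((y - (1 - l1)) / l1) => /=.
  by rewrite divr_ge0 ?ler_pdivrMr ?mul1r //; lra.
by rewrite mulrC divfK ?subrK // gt_eqF.
Qed.

(** Pulling y back by an inverse branch finds the last letter of the word first.
    The starting point x can be arbitrary because the word contracts all of
    [0, 1] towards y. *)
Lemma zeta_code_dense m x y :
  0 < l0 -> l0 <= l1 -> l1 < 1 -> 1 <= l0 + l1 ->
  0 <= x <= 1 -> 0 <= y <= 1 ->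
  exists2 g : code, size g = m & `|zeta_code l0 l1 g x - y| <= l1 ^+ m.
Proof.
move=> l0_gt0 l0_le l1_lt1 l01 x01; elim: m y => [|m IHm] y y01.
  by exists [::]; rewrite //= expr0 ler_norml; lra.
have [a [y' y'01 <-]] := zeta_cover y l0_gt0 l0_le l1_lt1 l01 y01.
have [g gm gy'] := IHm y' y'01.
exists (rcons g a); first by rewrite size_rcons gm.
rewrite /zeta_code -cats1 foldl_cat /= -/(zeta_code _ _ _ _) exprS.
by rewrite (le_trans (zeta_contract _ _ _ _ _)) // ler_wpM2l //; lra.
Qed.

End ContractingMaps.

(** * Geometry of the bridges *)

Lemma ubridge_cons (R : realType) (lu : R) a s x :
    `[0, 1]%classic x -> V lu a x -> ubridge lu s (xi lu a x) ->
  ubridge lu (a :: s) x.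
Proof. by move=> x01 Vx [_ sx]; split=> // -[|i] //= /sx. Qed.

Lemma ubridge_cat (R : realType) (lu : R) s t :
  ubridge lu (s ++ t) `<=` ubridge lu s.
Proof.
move=> x [x01 stx]; split=> // i i_lt.
have := stx i; rewrite nth_cat takel_cat ?(ltnW i_lt) // i_lt size_cat.
by apply; rewrite ltn_addr.
Qed.

(** The interval around c has the full length lu ^ -(size s) of the bridge.  It
    can be pulled back through the expanding maps because, for the affine map
    xi a on the whole line, the preimage of [0, 1] is exactly V a. *)
Lemma ubridge_center (R : realType) (lu : R) s : 1 <= lu ->
  exists c, forall x, `|x - c| <= (2 * lu ^+ size s)^-1 -> ubridge lu s x.
Proof.
move=> lu_ge1; have lu_gt0 : 0 < lu by lra.
have lu_neq0 : lu != 0 by rewrite gt_eqF.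
have luV1 : lu^-1 <= 1 by rewrite invf_le1.
elim: s => [|a s [c IHs]].
  exists 2^-1 => x /=; rewrite expr0 mulr1 ler_norml => x_near.
  by split=> //=; rewrite in_itv /=; lra.
exists (if a then 1 - c / lu else c / lu) => x x_near.
have xi_near : `|xi lu a x - c| <= (2 * lu ^+ size s)^-1.
  have -> : `|xi lu a x - c| = lu * `|x - (if a then 1 - c / lu else c / lu)|.
    rewrite -{2}(gtr0_norm lu_gt0) -normrM mulrBr.
    case: a {x_near} => /=; last by rewrite mulrCA mulfV ?mulr1.
    by rewrite -normrN !mulrBr mulr1 mulrCA mulfV // mulr1; congr `|_|; lra.
  by rewrite mulrC -ler_pdivlMr // -invfM -mulrA -exprSr.
have xi_s := IHs _ xi_near.
have [xi01 _] := xi_s.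
have luV x' : (0 <= lu * x' <= 1) = (0 <= x' <= lu^-1).
  by rewrite pmulr_rge0 // -ler_pdivlMl // mulr1.
have Vx : V lu a x.
  move: xi01; rewrite /V; case: a {x_near xi_near xi_s} => /=;
    rewrite !in_itv /= luV //; lra.
apply: ubridge_cons => //.
by move: Vx; rewrite /V; case: a {x_near xi_near xi_s xi01} => /=;
  rewrite !in_itv /=; lra.
Qed.

Lemma ubridge_seq_sub (R : realType) (lu : R) n0 wt w k :
  bridge_codes lu n0 wt w -> ubridge lu (w k.+1) `<=` ubridge lu (wt 0%N).
Proof.
move=> [_ wtw].
have wt_sub j : ubridge lu (wt j) `<=` ubridge lu (wt 0%N).
  elim: j => // j; apply: subset_trans.
  by have [a [-> _ _]] := wtw j.+1 isT; rewrite -cats1; apply: ubridge_cat.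
apply: subset_trans (wt_sub k).
by have [a [_ -> _]] := wtw k.+1 isT; rewrite -cats1; apply: ubridge_cat.
Qed.

(** * Comparison of exponential rates *)

Lemma expr_small (R : realType) (q e : R) : 0 < q -> q < 1 -> 0 < e ->
  exists2 n, (0 < n)%N & q ^+ n <= e.
Proof.
move=> q_gt0 q_lt1 e_gt0; set h := q^-1 - 1.
have h_gt0 : 0 < h by rewrite subr_gt0 invf_gt1.
have bernoulli n : n%:R * h <= q^-1 ^+ n.
  suff : 1 + n%:R * h <= q^-1 ^+ n by lra.
  elim: n => [|n IHn]; first by rewrite expr0; lra.
  have nh_ge0 : 0 <= n%:R * h by rewrite mulr_ge0 // ltW.
  have -> : q^-1 = 1 + h by rewrite /h; lra.
  have IHn' : 1 + n%:R * h <= (1 + h) ^+ n.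
    by have -> : 1 + h = q^-1 by rewrite /h; lra.
  by rewrite exprS -natr1; nra.
pose n := (Num.bound (e * h)^-1).+1; exists n => //.
have n_large : (e * h)^-1 <= n%:R.
  rewrite (le_trans (ltW (archi_boundP _))) ?ler_nat //.
  by rewrite invr_ge0 mulr_ge0 ?ltW.
rewrite -[leLHS]invrK invf_ple ?posrE ?invr_gt0 ?exprn_gt0 // -exprVn.
apply: le_trans (bernoulli n).
by rewrite -ler_pdivrMr // -invfM.
Qed.

(** N1 makes q ^ N1 beat the rate of decay, and N0 absorbs the constant. *)
Lemma expr_le_geometric (R : realType) (q A l : R) (b c : nat) :
    0 < q -> q < 1 -> 0 < A -> 0 < l ->
  exists N0 N1, [/\ (0 < N0)%N, (0 < N1)%N &
    forall k, q ^+ (N0 + N1 * k) <= A / l ^+ (b + c * k)].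
Proof.
move=> q_gt0 q_lt1 A_gt0 l_gt0.
have [N0 N0_gt0 qN0] : exists2 n, (0 < n)%N & q ^+ n <= A / l ^+ b.
  by apply: expr_small; rewrite ?divr_gt0 ?exprn_gt0.
have [N1 N1_gt0 qN1] : exists2 n, (0 < n)%N & q ^+ n <= (l ^+ c)^-1.
  by apply: expr_small; rewrite ?invr_gt0 ?exprn_gt0.
exists N0, N1; split=> // k.
rewrite !exprD !exprM invfM mulrA -(exprVn (l ^+ c)).
have qk_ge0 : 0 <= (q ^+ N1) ^+ k by rewrite !exprn_ge0 // ltW.
rewrite ler_pM ?exprn_ge0 ?(ltW q_gt0) //.
by rewrite lerXn2r ?nnegrE ?invr_ge0 ?exprn_ge0 ?(ltW q_gt0) ?(ltW l_gt0).
Qed.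

(** * Steering into the next cs-interval *)

Theorem lemma2p1 (R : realType) (lss lcs0 lcs1 lu a2 : R)
    (lss_gt0 : 0 < lss) (lcs0_gt0 : 0 < lcs0) (lcs1_gt0 : 0 < lcs1)
    (lu_gt0 : 0 < lu)
    (lss_lt : lss < lcs0) (lcs0_lt : lcs0 < 2^-1) (lcs1_gt : 2^-1 < lcs1)
    (lcs1_lt1 : lcs1 < 1) (lcs_sum : 1 < lcs0 + lcs1) (lu_gt2 : 2 < lu)
    (l_prod : lcs0 * lcs1 * lu ^+ 2 < 1) (a2_gt0 : 0 < a2)
    (n0 : nat) (wt w : nat -> code)
    (w_seq : bridge_codes lu n0 wt w)
    (B0_sub : ubridge lu (wt 0%N) `<=` `]0, a2[%classic)
    (L : nat) (L_gt0 : (0 < L)%N)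
    (wbar : nat -> code)
    (wbar_size : forall k, (0 < k)%N -> size (wbar k) = (n0 + k + L * k)%N)
    (wbar_sub : forall k, (0 < k)%N ->
       ubridge lu (wbar k) `<=` ubridge lu (w k))
    (u : nat -> code) :
  exists (N0 N1 : nat) (what v gam : nat -> code),
    [/\ (0 < N0)%N, (0 < N1)%N &
      forall k, (0 < k)%N ->
        [/\ ubridge lu (what k) `<=` ubridge lu (wbar k),
            what k = wbar k ++ v k ++ gam k,
            (0 < size (gam k) <= N0 + N1 * k)%N,
            v k = u k \/ (exists alpha : bool, v k = rcons (u k) alpha) &
            cs_interval a2 (ubridge lu (wbar k.+1))
              (zeta_code lcs0 lcs1 (what k) 2^-1) /\
            cs_interval a2 (ubridge lu (what k.+1)) `<=`
              cs_interval a2 (ubridge lu (wbar k.+1))]].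
Proof.
have c1_gt0 : 0 < 2^-1 / a2 by rewrite divr_gt0 // invr_gt0.
(* wbar (k + 1) has length (n0 + L.+1) + L.+1 * k. *)
have [N0 [N1 [N0_gt0 N1_gt0 rate]]] :=
  expr_le_geometric R lcs1 (2^-1 / a2) lu (n0 + L.+1) L.+1
    lcs1_gt0 lcs1_lt1 c1_gt0 lu_gt0.
have a2_neq0 : a2 != 0 by rewrite gt_eqF.
have steer k : exists g : code, (0 < k)%N ->
    size g = (N0 + N1 * k)%N /\
    cs_interval a2 (ubridge lu (wbar k.+1))
      (zeta_code lcs0 lcs1 (wbar k ++ u k ++ g) 2^-1).
  have lu_ge1 : 1 <= lu by lra.
  have [c c_ball] := ubridge_center R lu (wbar k.+1) lu_ge1.
  have c_bridge : ubridge lu (wbar k.+1) c.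
    by apply: c_ball; rewrite subrr normr0 invr_ge0 mulr_ge0 ?exprn_ge0 ?ltW.
  have c_a2 : 0 <= a2^-1 * c <= 1.
    have := B0_sub _ (ubridge_seq_sub _ _ _ _ _ k w_seq _
              (wbar_sub _ (ltn0Sn k) _ c_bridge)).
    rewrite /= in_itv /= => /andP[c_gt0 c_lt].
    by rewrite mulr_ge0 ?invr_ge0 ?(ltW a2_gt0) ?(ltW c_gt0) //=
      mulrC ler_pdivrMr ?mul1r ?(ltW c_lt).
  have l01 : lcs0 <= lcs1 by lra.
  have x01 : 0 <= zeta_code lcs0 lcs1 (wbar k ++ u k) 2^-1 <= 1.
    by apply: zeta_code_unit => //; lra.
  have [g g_size g_near] := zeta_code_dense _ _ _ (N0 + N1 * k) _ _
    lcs0_gt0 l01 lcs1_lt1 (ltW lcs_sum) x01 c_a2.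
  exists g => k_gt0; split=> //.
  rewrite catA /zeta_code foldl_cat -!/(zeta_code _ _ _ _).
  move: g_near; set z := zeta_code _ _ g _ => g_near.
  exists (a2 * z); last by rewrite mulKf.
  apply: c_ball; rewrite wbar_size //.
  have -> : a2 * z - c = a2 * (z - a2^-1 * c) by rewrite mulrBr mulVKf.
  rewrite normrM (gtr0_norm a2_gt0) mulrC -ler_pdivlMr //.
  apply: le_trans g_near (le_trans (rate k) _).
  have -> : (n0 + k.+1 + L * k.+1 = n0 + L.+1 + L.+1 * k)%N.
    by rewrite -addnA -mulSn mulnS addnA.
  by rewrite invfM mulrAC.
have [gam gamP] := choice steer.
exists N0, N1, (fun k => wbar k ++ u k ++ gam k), u, gam; split=> // k k_gt0.
have [gam_size gam_in] := gamP k k_gt0.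
split=> //.
- exact: ubridge_cat.
- by rewrite gam_size leqnn andbT addn_gt0 N0_gt0.
- by left.
- by split=> //; apply: image_subset; apply: ubridge_cat.
Qed.
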